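(* Let $\mathscr A$ and $\mathscr B$ be abelian categories with enough projectives and let $(\mathscr B,\mathscr A,\mathsf e,\mathsf l,\mathsf i)$ be a cleft extension $\mathscr A$ of $\mathscr B$ such that the functor $\mathsf l$ is exact and the functor $\mathsf e$ preserves projectives. Let $F\colon\mathscr B\to\mathscr B$ and $G\colon\mathscr A\to\mathscr A$ be the associated endofunctors, and assume that there are integers $n_{\mathscr B},n_{\mathscr A}\ge 0$ such that every object in the essential image of $F$ has projective dimension at most $n_{\mathscr B}$ in $\mathscr B$, and every object in the essential image of $G$ has projective dimension at most $n_{\mathscr A}$ in $\mathscr A$. Then: (i) $\operatorname{Fin.dim}\mathscr A\le\max\{\operatorname{Fin.dim}\mathscr B,\ n_{\mathscr A}+1\}$. (ii) $\operatorname{Fin.dim}\mathscr B\le\max\{\operatorname{Fin.dim}\mathscr A,\ n_{\mathscr B}+1\}$. In particular, $\operatorname{Fin.dim}\mathscr A<\infty$ if and only if $\operatorname{Fin.dim}\mathscr B<\infty$.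
   Context: A cleft extension $(\mathscr B,\mathscr A,\mathsf e,\mathsf l,\mathsf i)$ of an abelian category $\mathscr B$ is an abelian category $\mathscr A$ together with functors $\mathsf i\colon\mathscr B\to\mathscr A$, $\mathsf e\colon\mathscr A\to\mathscr B$, $\mathsf l\colon\mathscr B\to\mathscr A$ such that: (a) $\mathsf e$ is faithful exact; (b) $(\mathsf l,\mathsf e)$ is an adjoint pair; (c) there is a natural isomorphism $\mathsf e\mathsf i\simeq\mathrm{Id}_{\mathscr B}$. Let $\mu\colon\mathsf l\mathsf e\to\mathrm{Id}_{\mathscr A}$ be the counit of $(\mathsf l,\mathsf e)$; each $\mu_A$ is an epimorphism. The endofunctor $G\colon\mathscr A\to\mathscr A$ is $G(A)=\operatorname{Ker}\mu_A$, so there are exact sequences $0\to G(A)\to\mathsf l\mathsf e(A)\xrightarrow{\mu_A}A\to0$. The endofunctor $F\colon\mathscr B\to\mathscr B$ is $F(B)=\mathsf e(G(\mathsf i(B)))$, so, identifying $\mathsf e\mathsf i(B)$ with $B$, there are exact sequences $0\to F(B)\to\mathsf e\mathsf l(B)\to B\to0$. For an abelian category $\mathscr A$ with enough projectives, $\operatorname{Fin.dim}\mathscr A=\sup\{\operatorname{pd}_{\mathscr A}A\mid A\in\mathscr A,\ \operatorname{pd}_{\mathscr A}A<\infty\}$. *)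

(* Defs.v *)
From mathcomp Require Import all_boot all_order all_algebra.
From mathcomp Require Import boolp classical_sets constructive_ereal.

Set Implicit Arguments.
Unset Strict Implicit.
Unset Printing Implicit Defensive.

Import Order.TTheory GRing.Theory Num.Theory.

Local Open Scope ring_scope.

Reserved Notation "g \cc f" (at level 40, left associativity).

(* The decidable equality and choice operator that zmodType imposes on the Hom
   groups exist classically on every type, so they restrict nothing. *)
Record preadditive := Preadditive {
  Ob :> Type;
  Hom : Ob -> Ob -> zmodType;
  idm : forall X, Hom X X;
  comp : forall X Y Z, Hom Y Z -> Hom X Y -> Hom X Z;
  comp1m : forall X Y (f : Hom X Y), comp (idm Y) f = f;
  compm1 : forall X Y (f : Hom X Y), comp f (idm X) = f;
  compA : forall X Y Z W (h : Hom Z W) (g : Hom Y Z) (f : Hom X Y),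
    comp h (comp g f) = comp (comp h g) f;
  compDl : forall X Y Z (g g' : Hom Y Z) (f : Hom X Y),
    comp (g + g') f = comp g f + comp g' f;
  compDr : forall X Y Z (g : Hom Y Z) (f f' : Hom X Y),
    comp g (f + f') = comp g f + comp g f'
}.

Arguments Hom {p} X Y.
Arguments idm {p} X.
Arguments comp {p X Y Z} g f.

Notation "g \cc f" := (comp g f).

Section Morphisms.
Variable C : preadditive.
Implicit Types X Y Z K Q : C.

Definition mono X Y (f : Hom X Y) : Prop :=
  forall Z (g h : Hom Z X), f \cc g = f \cc h -> g = h.

Definition epi X Y (f : Hom X Y) : Prop :=
  forall Z (g h : Hom Y Z), g \cc f = h \cc f -> g = h.

Definition iso X Y (f : Hom X Y) : Prop :=
  exists g : Hom Y X, g \cc f = idm X /\ f \cc g = idm Y.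

Definition isomorphic X Y : Prop := exists f : Hom X Y, iso f.

Definition zero_object Z : Prop :=
  (forall X (f : Hom X Z), f = 0) /\ (forall X (f : Hom Z X), f = 0).

Definition is_kernel X Y (f : Hom X Y) K (k : Hom K X) : Prop :=
  f \cc k = 0 /\
  forall Z (g : Hom Z X), f \cc g = 0 -> exists! h : Hom Z K, k \cc h = g.

Definition is_cokernel X Y (f : Hom X Y) Q (q : Hom Y Q) : Prop :=
  q \cc f = 0 /\
  forall Z (g : Hom Y Z), g \cc f = 0 -> exists! h : Hom Q Z, h \cc q = g.

Definition is_biproduct X Y S (i1 : Hom X S) (i2 : Hom Y S)
    (p1 : Hom S X) (p2 : Hom S Y) : Prop :=
  [/\ p1 \cc i1 = idm X, p2 \cc i2 = idm Y, p1 \cc i2 = 0, p2 \cc i1 = 0 &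
      i1 \cc p1 + i2 \cc p2 = idm S].

Record is_abelian : Prop := IsAbelian {
  has_zero : exists Z, zero_object Z;
  has_biproducts : forall X Y, exists S (i1 : Hom X S) (i2 : Hom Y S)
    (p1 : Hom S X) (p2 : Hom S Y), is_biproduct i1 i2 p1 p2;
  has_kernels : forall X Y (f : Hom X Y),
    exists K (k : Hom K X), is_kernel f k;
  has_cokernels : forall X Y (f : Hom X Y),
    exists Q (q : Hom Y Q), is_cokernel f q;
  mono_normal : forall X Y (f : Hom X Y), mono f ->
    exists Z (g : Hom Y Z), is_kernel g f;
  epi_normal : forall X Y (f : Hom X Y), epi f ->
    exists Z (g : Hom Z X), is_cokernel g f
}.

Definition is_image X Y (f : Hom X Y) J (m : Hom J Y) : Prop :=
  exists Q (q : Hom Y Q), is_cokernel f q /\ is_kernel q m.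

(* The subobjects Im f and Ker g of Y coincide. *)
Definition exact_at X Y Z (f : Hom X Y) (g : Hom Y Z) : Prop :=
  exists J (m : Hom J Y), is_image f m /\ is_kernel g m.

Definition short_exact X Y Z (f : Hom X Y) (g : Hom Y Z) : Prop :=
  [/\ mono f, exact_at f g & epi g].

Definition projective P : Prop :=
  forall X Y (p : Hom X Y) (f : Hom P Y), epi p ->
    exists g : Hom P X, p \cc g = f.

Definition enough_projectives : Prop :=
  forall X, exists P (p : Hom P X), projective P /\ epi p.

End Morphisms.

Record abelian_category := AbelianCategory {
  ab_base :> preadditive;
  ab_axioms : is_abelian ab_base
}.

Record functor (C D : preadditive) := Functor {
  fob :> C -> D;
  fmap : forall X Y : C, Hom X Y -> Hom (fob X) (fob Y);
  fmap1 : forall X : C, fmap (idm X) = idm (fob X);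
  fmapM : forall (X Y Z : C) (g : Hom Y Z) (f : Hom X Y),
    fmap (g \cc f) = fmap g \cc fmap f
}.

Arguments fmap {C D} T {X Y} _ : rename.

Definition id_functor (C : preadditive) : functor C C :=
  @Functor C C id (fun _ _ f => f) (fun _ => erefl) (fun _ _ _ _ _ => erefl).

Program Definition comp_functor (C D E : preadditive)
    (T : functor D E) (S : functor C D) : functor C E :=
  @Functor C E (fun X => T (S X)) (fun _ _ f => fmap T (fmap S f)) _ _.
Next Obligation. by move=> *; rewrite !fmap1. Qed.
Next Obligation. by move=> *; rewrite !fmapM. Qed.

Definition faithful (C D : preadditive) (T : functor C D) : Prop :=
  forall (X Y : C) (f g : Hom X Y), fmap T f = fmap T g -> f = g.

Definition additive_functor (C D : preadditive) (T : functor C D) : Prop :=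
  forall (X Y : C) (f g : Hom X Y), fmap T (f + g) = fmap T f + fmap T g.

Definition exact_functor (C D : preadditive) (T : functor C D) : Prop :=
  additive_functor T /\
  forall (X Y Z : C) (f : Hom X Y) (g : Hom Y Z),
    short_exact f g -> short_exact (fmap T f) (fmap T g).

Definition preserves_projectives (C D : preadditive) (T : functor C D) : Prop :=
  forall P : C, projective P -> projective (T P).

Definition essential_image (C D : preadditive) (T : functor C D) (Y : D) : Prop :=
  exists X : C, isomorphic (T X) Y.

Record nat_trans (C D : preadditive) (S T : functor C D) := NatTrans {
  nt :> forall X : C, Hom (S X) (T X);
  nt_natural : forall (X Y : C) (f : Hom X Y),
    nt Y \cc fmap S f = fmap T f \cc nt X
}.

Record nat_iso (C D : preadditive) (S T : functor C D) := NatIso {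
  ni_trans :> nat_trans S T;
  ni_iso : forall X : C, iso (ni_trans X)
}.

Record adjunction (C D : preadditive) (L : functor C D) (R : functor D C) :=
Adjunction {
  adj_unit : nat_trans (id_functor C) (comp_functor R L);
  adj_counit : nat_trans (comp_functor L R) (id_functor D);
  adj_triangleL : forall X : C,
    adj_counit (L X) \cc fmap L (adj_unit X) = idm (L X);
  adj_triangleR : forall Y : D,
    fmap R (adj_counit Y) \cc adj_unit (R Y) = idm (R Y)
}.

Section Kernels.
Variable C : abelian_category.

Definition Ker (X Y : C) (f : Hom X Y) : C :=
  sval (cid (has_kernels (ab_axioms C) f)).

Definition ker (X Y : C) (f : Hom X Y) : Hom (Ker f) X :=
  sval (cid (svalP (cid (has_kernels (ab_axioms C) f)))).

Lemma kerP (X Y : C) (f : Hom X Y) : is_kernel f (ker f).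
Proof. exact: (svalP (cid (svalP (cid (has_kernels (ab_axioms C) f))))). Qed.

Lemma ker_mono (X Y : C) (f : Hom X Y) : mono (ker f).
Proof.
move=> Z g h gh; have [fk0 uni] := kerP f.
have fkh0 : f \cc (ker f \cc h) = 0.
  have -> : f \cc (ker f \cc h) = 0 \cc h by rewrite compA fk0.
  by apply: (@addIr _ (0 \cc h)); rewrite -compDl !add0r.
have [u [_ uu]] := uni _ _ fkh0.
by rewrite -(uu g gh) -(uu h erefl).
Qed.

Lemma ker_lift_ex (X Y : C) (f : Hom X Y) (Z : C) (g : Hom Z X) :
  f \cc g = 0 -> exists h : Hom Z (Ker f), ker f \cc h = g.
Proof. by move=> /((kerP f).2 _ _)[h [hg _]]; exists h. Qed.

Definition ker_lift (X Y : C) (f : Hom X Y) (Z : C) (g : Hom Z X)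
    (fg0 : f \cc g = 0) : Hom Z (Ker f) := sval (cid (ker_lift_ex fg0)).

Lemma ker_liftK (X Y : C) (f : Hom X Y) (Z : C) (g : Hom Z X)
  (fg0 : f \cc g = 0) : ker f \cc ker_lift fg0 = g.
Proof. exact: (svalP (cid (ker_lift_ex fg0))). Qed.

Variables (D : preadditive) (S T : functor D C) (a : nat_trans S T).

Lemma ker_map_subproof (X Y : D) (f : Hom X Y) :
  a Y \cc (fmap S f \cc ker (a X)) = 0.
Proof.
rewrite compA nt_natural -compA (kerP (a X)).1.
by apply: (@addIr _ (fmap T f \cc 0)); rewrite -compDr !add0r.
Qed.

Lemma ker_functor_id (X : D) :
  ker_lift (ker_map_subproof (idm X)) = idm (Ker (a X)).
Proof. by apply: (@ker_mono _ _ (a X)); rewrite ker_liftK fmap1 comp1m compm1. Qed.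

Lemma ker_functor_comp (X Y Z : D) (g : Hom Y Z) (f : Hom X Y) :
  ker_lift (ker_map_subproof (g \cc f)) =
  ker_lift (ker_map_subproof g) \cc ker_lift (ker_map_subproof f).
Proof.
apply: (@ker_mono _ _ (a Z)).
by rewrite compA !ker_liftK -compA ker_liftK fmapM compA.
Qed.

Definition ker_functor : functor D C :=
  @Functor D C (fun X => Ker (a X))
    (fun X Y f => ker_lift (ker_map_subproof f))
    ker_functor_id ker_functor_comp.

End Kernels.

(* The unit and counit of (l, e) and the isomorphism e i = Id are part of the
   data; mu is the counit. *)
Record cleft_extension (B A : abelian_category) := CleftExtension {
  cl_e : functor A B;
  cl_l : functor B A;
  cl_i : functor B A;
  cl_faithful : faithful cl_e;
  cl_exact : exact_functor cl_e;
  cl_adj : adjunction cl_l cl_e;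
  cl_section : nat_iso (comp_functor cl_e cl_i) (id_functor B)
}.

Section CleftFunctors.
Variables (B A : abelian_category) (c : cleft_extension B A).

Definition cleft_G : functor A A := ker_functor (adj_counit (cl_adj c)).

Definition cleft_F : functor B B :=
  comp_functor (cl_e c) (comp_functor cleft_G (cl_i c)).

End CleftFunctors.

Section Dimensions.
Variable C : preadditive.

Record projective_resolution (X : C) := ProjectiveResolution {
  pr_ob : nat -> C;
  pr_d : forall k, Hom (pr_ob k.+1) (pr_ob k);
  pr_aug : Hom (pr_ob 0) X;
  pr_projective : forall k, projective (pr_ob k);
  pr_epi : epi pr_aug;
  pr_exact0 : exact_at (pr_d 0) pr_aug;
  pr_exact : forall k, exact_at (pr_d k.+1) (pr_d k)
}.

Definition resolution_length_le (X : C) (P : projective_resolution X)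
    (n : nat) : Prop :=
  forall k, (n < k)%N -> zero_object (pr_ob P k).

(* Extended integers serve as values: the projective dimension is +oo when
   there is no finite projective resolution, and it is 0 on zero objects. The
   infimum and the supremum below always exist, being taken over sets of
   natural numbers. *)
Definition pd (X : C) : \bar int :=
  infimum +oo%E [set (Posz n)%:E | n in
    [set n | exists P : projective_resolution X, resolution_length_le P n]]%classic.

Definition Findim : \bar int :=
  supremum -oo%E [set pd X | X in [set X | (pd X < +oo)%E]]%classic.

End Dimensions.

(* Main.v *)
(* For X in A the sequence 0 -> G X -> l e X -> X -> 0 gives
   pd X <= max (pd (l e X)) (pd (G X) + 1). Both l and e are exact and preserve
   projectives (l because its right adjoint e preserves epimorphisms), so
   pd (l e X) <= pd (e X) <= pd X; hence pd (e X) is finite and bounds the first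
   term by Findim B. Symmetrically, applying e to the sequence of i Y gives
   0 -> F Y -> e l e i Y -> e i Y -> 0 with e i Y isomorphic to Y, where
   pd (e l e i Y) <= pd (l e i Y) <= pd Y. *)
Require Import Defs.
From mathcomp Require Import all_boot all_order all_algebra.
From mathcomp Require Import boolp classical_sets constructive_ereal.

(* Reclaims [Hom], which mathcomp's vector.v shadows. *)
Import Defs.

Set Implicit Arguments.
Unset Strict Implicit.
Unset Printing Implicit Defensive.

Import Order.TTheory GRing.Theory Num.Theory.

Local Open Scope ring_scope.

(** * Morphism calculus, kernels and cokernels in a preadditive category *)

Section Preadditive.
Variable C : preadditive.
Implicit Types X Y Z K P Q : C.

Lemma comp0m X Y Z (f : Hom X Y) : (0 : Hom Y Z) \cc f = 0.
Proof. by apply: (@addIr _ (0 \cc f)); rewrite -compDl !add0r. Qed.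

Lemma compm0 X Y Z (g : Hom Y Z) : g \cc (0 : Hom X Y) = 0.
Proof. by apply: (@addIr _ (g \cc 0)); rewrite -compDr !add0r. Qed.

Lemma compNm X Y Z (g : Hom Y Z) (f : Hom X Y) : (- g) \cc f = - (g \cc f).
Proof. by apply/eqP; rewrite -addr_eq0 -compDl addNr comp0m. Qed.

Lemma compmN X Y Z (g : Hom Y Z) (f : Hom X Y) : g \cc (- f) = - (g \cc f).
Proof. by apply/eqP; rewrite -addr_eq0 -compDr addNr compm0. Qed.

Lemma compBl X Y Z (g g' : Hom Y Z) (f : Hom X Y) :
  (g - g') \cc f = g \cc f - g' \cc f.
Proof. by rewrite compDl compNm. Qed.

Lemma compBr X Y Z (g : Hom Y Z) (f f' : Hom X Y) :
  g \cc (f - f') = g \cc f - g \cc f'.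
Proof. by rewrite compDr compmN. Qed.

Lemma epi0 X Y (f : Hom X Y) :
  (forall Z (h : Hom Y Z), h \cc f = 0 -> h = 0) -> epi f.
Proof.
by move=> f0 Z g h gh; apply/eqP; rewrite -subr_eq0; apply/eqP/f0;
  rewrite compBl gh subrr.
Qed.

Lemma mono0 X Y (f : Hom X Y) :
  (forall Z (h : Hom Z X), f \cc h = 0 -> h = 0) -> mono f.
Proof.
by move=> f0 Z g h gh; apply/eqP; rewrite -subr_eq0; apply/eqP/f0;
  rewrite compBr gh subrr.
Qed.

Lemma epi_comp X Y Z (g : Hom Y Z) (f : Hom X Y) :
  epi g -> epi f -> epi (g \cc f).
Proof. by move=> eg ef W h k; rewrite !compA => /ef /eg. Qed.

Lemma epi_cancel X Y Z (g : Hom Y Z) (f : Hom X Y) : epi (g \cc f) -> epi g.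
Proof. by move=> egf W h k hk; apply: egf; rewrite !compA hk. Qed.

Lemma mono_comp X Y Z (g : Hom Y Z) (f : Hom X Y) :
  mono g -> mono f -> mono (g \cc f).
Proof. by move=> mg mf W h k; rewrite -!compA => /mg /mf. Qed.

Lemma epi_idm X : epi (idm X).
Proof. by move=> Z g h; rewrite !compm1. Qed.

Lemma iso_epi X Y (f : Hom X Y) : iso f -> epi f.
Proof.
by case=> g [_ fg]; apply: (@epi_cancel _ _ _ _ g); rewrite fg; exact: epi_idm.
Qed.

Lemma isomorphic_sym X Y : isomorphic X Y -> isomorphic Y X.
Proof. by case=> f [g [gf fg]]; exists g, f. Qed.

Lemma isomorphic_refl X : isomorphic X X.
Proof. by exists (idm X), (idm X); rewrite comp1m. Qed.

Lemma zero_object_projective Z : zero_object Z -> projective Z.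
Proof. by case=> _ Z0 X Y p f _; exists 0; rewrite compm0 (Z0 _ f). Qed.

Lemma kernel_mono X Y (f : Hom X Y) K (k : Hom K X) : is_kernel f k -> mono k.
Proof.
case=> fk0 uni; apply: mono0 => Z h kh0.
have [|u [_ uu]] := uni Z 0; first by rewrite compm0.
by rewrite -(uu h kh0) -(uu 0) ?compm0.
Qed.

Lemma kernel_lift X Y (f : Hom X Y) K (k : Hom K X) Z (g : Hom Z X) :
  is_kernel f k -> f \cc g = 0 -> exists h, k \cc h = g.
Proof. by case=> _ uni /uni[h [hg _]]; exists h. Qed.

Lemma mono_is_kernel X Y (f : Hom X Y) K (k : Hom K X) :
  mono k -> f \cc k = 0 ->
  (forall Z (g : Hom Z X), f \cc g = 0 -> exists h, k \cc h = g) ->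
  is_kernel f k.
Proof.
move=> mk fk0 lift; split=> // Z g /lift[h hg].
by exists h; split=> // h' h'g; apply: mk; rewrite hg h'g.
Qed.

Lemma zero_object_mono X Z (f : Hom Z X) : zero_object Z -> mono f.
Proof. by case=> toZ _ W a b _; rewrite (toZ _ a) (toZ _ b). Qed.

Lemma zero_kernel_idm X Z : zero_object Z -> is_kernel (idm X) (0 : Hom Z X).
Proof.
move=> Z0; apply: mono_is_kernel => [||W h]; first exact: zero_object_mono.
  exact: compm0.
by rewrite comp1m => ->; exists 0; rewrite compm0.
Qed.

Lemma cokernel_epi X Y (f : Hom X Y) Q (q : Hom Y Q) : is_cokernel f q -> epi q.
Proof.
case=> qf0 uni; apply: epi0 => Z h hq0.
have [|u [_ uu]] := uni Z 0; first by rewrite comp0m.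
by rewrite -(uu h hq0) -(uu 0) ?comp0m.
Qed.

Lemma cokernel_desc X Y (f : Hom X Y) Q (q : Hom Y Q) Z (g : Hom Y Z) :
  is_cokernel f q -> g \cc f = 0 -> exists h, h \cc q = g.
Proof. by case=> _ uni /uni[h [hg _]]; exists h. Qed.

Lemma epi_is_cokernel X Y (f : Hom X Y) Q (q : Hom Y Q) :
  epi q -> q \cc f = 0 ->
  (forall Z (g : Hom Y Z), g \cc f = 0 -> exists h, h \cc q = g) ->
  is_cokernel f q.
Proof.
move=> eq qf0 desc; split=> // Z g /desc[h hg].
by exists h; split=> // h' h'g; apply: eq; rewrite hg h'g.
Qed.

(** Over an abelian category this agrees with [short_exact]; the kernel form yields lifts directly,
    without an image. *)
Definition ses X Y Z (f : Hom X Y) (g : Hom Y Z) : Prop :=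
  is_kernel g f /\ epi g.

(** Projective dimension at most [n], read through successive syzygies so that inductions peel off
    one projective at a time. Over an abelian category it amounts to a projective resolution of
    length at most [n]. *)
Fixpoint pd_le (n : nat) X : Prop :=
  if n is m.+1 then
    exists K P (k : Hom K P) (p : Hom P X),
      [/\ ses k p, projective P & pd_le m K]
  else projective X.

Lemma projective_isomorphic X Y :
  isomorphic X Y -> projective X -> projective Y.
Proof.
case=> f [g [gf fg]] pX M N p h ep.
have [u pu] := pX _ _ p (h \cc f) ep.
by exists (u \cc g); rewrite compA pu -compA fg compm1.
Qed.

Lemma pd_le_isomorphic n X Y : isomorphic X Y -> pd_le n X -> pd_le n Y.
Proof.
case: n => [|n] XY; first exact: projective_isomorphic.
case=> K [P [k [p [[kp ep] pP pK]]]]; case: XY => f if_.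
exists K, P, k, (f \cc p); split=> //; split; last first.
  by apply: epi_comp => //; exact: iso_epi.
apply: mono_is_kernel.
- exact: kernel_mono kp.
- by rewrite -compA kp.1 compm0.
move=> Z g fpg; apply: (kernel_lift kp); case: if_ => f' [f'f _].
by rewrite -[LHS]comp1m -f'f -compA [f \cc _]compA fpg compm0.
Qed.

Lemma biproduct_projective X Y S (i1 : Hom X S) (i2 : Hom Y S) p1 p2 :
  is_biproduct i1 i2 p1 p2 -> projective X -> projective Y -> projective S.
Proof.
case=> _ _ _ _ sum pX pY M N p f ep.
have [u pu] := pX _ _ p (f \cc i1) ep.
have [v pv] := pY _ _ p (f \cc i2) ep.
by exists (u \cc p1 + v \cc p2);
  rewrite compDr !compA pu pv -!compA -compDr sum compm1.
Qed.

End Preadditive.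

(** * Normality, images and exactness in an abelian category *)

Section Abelian.
Variable C : preadditive.
Hypothesis aC : is_abelian C.
Implicit Types X Y Z K P Q : C.

(** The epimorphism [g] is a cokernel of some [z], and [z] factors through the kernel [f]; whatever
    kills [f] therefore kills [z]. *)
Lemma kernel_is_cokernel X Y Z (f : Hom X Y) (g : Hom Y Z) :
  ses f g -> is_cokernel f g.
Proof.
case=> kf eg; apply: epi_is_cokernel => //; first exact: kf.1.
have [W [z cg]] := epi_normal aC eg => V h hf0.
have [z' fz'] := kernel_lift kf cg.1.
by apply: (cokernel_desc cg); rewrite -fz' compA hf0 comp0m.
Qed.

Lemma mono_kernel_coker X Y Q (f : Hom X Y) (q : Hom Y Q) :
  mono f -> is_cokernel f q -> is_kernel q f.
Proof.
move=> mf cq; apply: mono_is_kernel => // [|V w qw0]; first exact: cq.1.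
have [Z [z kz]] := mono_normal aC mf.
have [z' z'q] := cokernel_desc cq kz.1.
by apply: (kernel_lift kz); rewrite -z'q -compA qw0 compm0.
Qed.

Lemma short_exact_ses X Y Z (f : Hom X Y) (g : Hom Y Z) :
  short_exact f g <-> ses f g.
Proof.
split=> [[mf [J [m [[Q [q [cq kq]]] kg]]] eg]|fg].
  have kf := mono_kernel_coker mf cq.
  split=> //; apply: mono_is_kernel => // [|V w gw0].
    by have [f' <-] := kernel_lift kq cq.1; rewrite compA kg.1 comp0m.
  have [w' <-] := kernel_lift kg gw0.
  by apply: (kernel_lift kf); rewrite compA kq.1 comp0m.
case: (fg) => kf eg; split=> //; first exact: kernel_mono kf.
by exists X, f; split=> //; exists Z, g; split=> //; exact: kernel_is_cokernel.
Qed.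

(** If [h] kills [f'], then [f] factors through the monomorphism [m \cc k], where [k] is a kernel of
    [h]. This monomorphism is a kernel of some [w]; since [w] kills [f], it factors through [q] and
    so kills [m]. Hence [m] factors through [m \cc k], which splits [k] and gives [h = 0]. *)
Lemma image_factor X Y J (f : Hom X Y) (m : Hom J Y) :
  is_image f m -> exists2 f' : Hom X J, m \cc f' = f & epi f'.
Proof.
case=> Q [q [cq km]]; have [f' mf'] := kernel_lift km cq.1.
exists f' => //; apply: epi0 => Z h hf'0.
have [K [k kh]] := has_kernels aC h.
have mm := kernel_mono km; have mk := kernel_mono kh.
have [W [w kw]] := mono_normal aC (mono_comp mm mk).
have [f'' kf''] := kernel_lift kh hf'0.
have [w' w'q] : exists w', w' \cc q = w.
  apply: (cokernel_desc cq).
  by rewrite -mf' -kf'' [m \cc _]compA [LHS]compA kw.1 comp0m.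
have [t mkt] : exists t, (m \cc k) \cc t = m.
  by apply: (kernel_lift kw); rewrite -w'q -compA km.1 compm0.
have kt : k \cc t = idm J by apply: mm; rewrite compA mkt compm1.
by rewrite -[h]compm1 -kt compA kh.1 comp0m.
Qed.

(** Since [f'] is epi, a cokernel of [k \cc f'] is also one of [k], and the monomorphism [k] is the
    kernel of its cokernel. *)
Lemma exact_at_intro X Y Z K (f' : Hom X K) (k : Hom K Y) (g : Hom Y Z) :
  epi f' -> is_kernel g k -> exact_at (k \cc f') g.
Proof.
move=> ef kg; exists K, k; split=> //.
have [Q [q cq]] := has_cokernels aC (k \cc f').
exists Q, q; split=> //; apply: mono_kernel_coker; first exact: kernel_mono kg.
apply: epi_is_cokernel; first exact: cokernel_epi cq.
  by apply: ef; rewrite comp0m -compA cq.1.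
by move=> V h hk; apply: (cokernel_desc cq); rewrite compA hk comp0m.
Qed.

Lemma exact_at_elim X Y Z (f : Hom X Y) (g : Hom Y Z) :
  exact_at f g -> exists K (k : Hom K Y) (f' : Hom X K),
    [/\ k \cc f' = f, epi f' & is_kernel g k].
Proof.
by case=> K [k [/image_factor[f' kf' ef'] kg]]; exists K, k, f'.
Qed.

(** Passes between a differential into a projective and its corestriction to the syzygy: [g] and
    [m \cc g] have the same kernels. *)
Lemma exact_at_mono_comp X Y Z W (f : Hom X Y) (g : Hom Y Z) (m : Hom Z W) :
  mono m -> exact_at f g <-> exact_at f (m \cc g).
Proof.
move=> mm; split=> -[K [k [im kg]]]; exists K, k; split=> //;
  have mk := kernel_mono kg.
  apply: mono_is_kernel => //; first by rewrite -compA kg.1 compm0.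
  by move=> V h; rewrite -compA => mgh; apply: (kernel_lift kg);
    apply: mm; rewrite mgh compm0.
apply: mono_is_kernel => //; first by apply: mm; rewrite compm0 compA kg.1.
by move=> V h gh; apply: (kernel_lift kg); rewrite -compA gh compm0.
Qed.

Lemma mono_epi_isomorphic X Y (f : Hom X Y) : mono f -> epi f -> isomorphic X Y.
Proof.
move=> mf ef.
have [Z [g kg]] := mono_normal aC mf.
have g0 : g = 0 by apply: ef; rewrite comp0m kg.1.
have [h fh] : exists h, f \cc h = idm Y.
  by apply: (kernel_lift kg); rewrite g0 comp0m.
by exists f, h; split=> //; apply: mf; rewrite compA fh comp1m compm1.
Qed.

(** * Projective resolutions versus iterated syzygies *)

Lemma resolution_pd_le n X (R : projective_resolution X) :
  resolution_length_le R n -> pd_le n X.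
Proof.
elim: n X R => [|n IHn] X R lenR.
  apply: (@projective_isomorphic _ (pr_ob R 0)); last exact: pr_projective.
  apply: (mono_epi_isomorphic _ (@pr_epi _ _ R)); apply: mono0 => Z h ah0.
  have [K [k [d' [kd' ed' ka]]]] := exact_at_elim (pr_exact0 R).
  have [h' <-] := kernel_lift ka ah0.
  (* Degree 1 vanishes, so the epimorphism [d'] onto the kernel of the augmentation is zero, which
     forces [k = 0]. *)
  have d'0 : d' = 0 by exact: (lenR 1%N isT).2.
  have -> : k = 0 by apply: ed'; rewrite d'0 !compm0.
  by rewrite comp0m.
have [K [k [d' [kd' ed' ka]]]] := exact_at_elim (pr_exact0 R).
have mk := kernel_mono ka.
exists K, (pr_ob R 0), k, (pr_aug R).
split; [by split=> //; exact: pr_epi | exact: pr_projective |].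
(* Dropping degree 0 leaves a resolution of the syzygy [K], with [d'] as augmentation. *)
have ex0 : exact_at (pr_d R 1) d'.
  by apply/(exact_at_mono_comp _ _ mk); rewrite kd'; exact: pr_exact.
pose R' := @ProjectiveResolution _ K (fun i => pr_ob R i.+1)
  (fun i => pr_d R i.+1) d' (fun i => @pr_projective _ _ R i.+1) ed' ex0
  (fun i => pr_exact R i.+1).
by have := IHn K R'; apply=> i ni; exact: lenR.
Qed.

Section Splice.
Variables (X K P : C) (k : Hom K P) (p : Hom P X).
Hypotheses (kp : ses k p) (pP : projective P).
Variable R : projective_resolution K.

Definition splice_ob (i : nat) : C := if i is j.+1 then pr_ob R j else P.

Definition splice_d (i : nat) : Hom (splice_ob i.+1) (splice_ob i) :=
  if i is j.+1 then pr_d R j else k \cc pr_aug R.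

Lemma splice_projective i : projective (splice_ob i).
Proof. by case: i => // i; exact: pr_projective. Qed.

Lemma splice_exact0 : exact_at (splice_d 0) p.
Proof. exact: exact_at_intro (@pr_epi _ _ R) kp.1. Qed.

Lemma splice_exact i : exact_at (splice_d i.+1) (splice_d i).
Proof.
case: i => [|i]; last exact: pr_exact.
by apply/(exact_at_mono_comp _ _ (kernel_mono kp.1)); exact: pr_exact0.
Qed.

Definition splice : projective_resolution X :=
  ProjectiveResolution splice_projective kp.2 splice_exact0 splice_exact.

End Splice.

Lemma pd_le_resolution n X :
  pd_le n X -> exists R : projective_resolution X, resolution_length_le R n.
Proof.
have [Z Z0] := has_zero aC.
(* The zero object [Z] fills the positive degrees of the resolution of a projective; exactness at
   those places is automatic. *)
have exZ U V (f : Hom U Z) (g : Hom Z V) : exact_at f g.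
  have -> : f = idm Z \cc f by rewrite comp1m.
  apply: exact_at_intro; first by apply: epi0 => W h _; exact: Z0.2.
  apply: mono_is_kernel => [||W h _].
  - exact: zero_object_mono.
  - by rewrite (Z0.2 _ g) comp0m.
  by exists h; rewrite comp1m.
elim: n X => [|n IHn] X.
  move=> pX.
  have pob i : projective (if i is 0 then X else Z).
    by case: i => // _; exact: zero_object_projective.
  have ex0 : exact_at (0 : Hom Z X) (idm X).
    have -> : (0 : Hom Z X) = 0 \cc idm Z by rewrite comp0m.
    apply: exact_at_intro; first exact: epi_idm.
    exact: zero_kernel_idm.
  pose R := @ProjectiveResolution C X (fun i => if i is 0 then X else Z)
    (fun i => 0) (idm X) pob (@epi_idm _ X) ex0 (fun i => exZ _ _ _ _).
  by exists R => -[].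
case=> K [P [k [p [kp pP /IHn[R lenR]]]]].
exists (splice kp pP R) => -[|i] // ni.
exact: lenR.
Qed.

Lemma pd_leS n X : pd_le n X -> pd_le n.+1 X.
Proof.
have [Z Z0] := has_zero aC.
elim: n X => [|n IHn] X; last first.
  by case=> K [P [k [p [kp pP /IHn pK]]]]; exists K, P, k, p.
(* A projective covers itself, with zero syzygy. *)
move=> pX; exists Z, X, 0, (idm X).
split=> //; last exact: zero_object_projective.
split; last exact: epi_idm.
exact: zero_kernel_idm.
Qed.

Lemma pd_le_leq m n X : (m <= n)%N -> pd_le m X -> pd_le n X.
Proof.
move=> /subnKC <-; elim: (n - m)%N => [|i IHi]; first by rewrite addn0.
by rewrite addnS => /IHi/pd_leS.
Qed.

(** * Projective dimension along short exact sequences *)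

Section EnoughProjectives.
Hypothesis C_enough : enough_projectives C.

(** Replaces element chasing in surjectivity proofs: lifting an epimorphism from a projective onto
    [Y] already makes [f] epi. *)
Lemma epi_from_lifts X Y (f : Hom X Y) :
  (forall P (g : Hom P Y), projective P -> exists h, f \cc h = g) -> epi f.
Proof.
move=> lift; have [P [p [pP ep]]] := C_enough Y.
by have [h fh] := lift P p pP; apply: (@epi_cancel _ _ _ _ _ h); rewrite fh.
Qed.

(** Take [S] to be the biproduct of [P] and [Q], mapped to [Y] by [f \cc p] on [P] and by a lift [s]
    of [q] along [g] on [Q]; [N] is the kernel of this map. *)
Lemma horseshoe X Y Z K1 P K2 Q (f : Hom X Y) (g : Hom Y Z)
    (k1 : Hom K1 P) (p : Hom P X) (k2 : Hom K2 Q) (q : Hom Q Z) :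
  ses f g -> ses k1 p -> ses k2 q -> projective P -> projective Q ->
  exists N S (u : Hom K1 N) (v : Hom N K2) (n : Hom N S) (r : Hom S Y),
    [/\ ses u v, ses n r & projective S].
Proof.
move=> fg [k1p ep] [k2q eQ] pP pQ; have [kf eg] := fg.
have [S [i1 [i2 [p1 [p2 bip]]]]] := has_biproducts aC P Q.
have pS := biproduct_projective bip pP pQ.
case: bip => p1i1 p2i2 p1i2 p2i1 sum.
have [s gs] := pQ _ _ g q eg.
pose r := f \cc p \cc p1 + s \cc p2.
have ri1 : r \cc i1 = f \cc p.
  by rewrite /r compDl -!compA p1i1 p2i1 !compm0 addr0 compm1.
have ri2 : r \cc i2 = s.
  by rewrite /r compDl -!compA p1i2 p2i2 !compm0 add0r compm1.
have gr : g \cc r = q \cc p2.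
  by rewrite /r compDr !compA kf.1 !comp0m add0r gs.
(* If [h] kills [r], it kills [f \cc p], hence [f], and descends to [h'] on [Z]; then
   [h' \cc q = h \cc s = 0]. *)
have er : epi r.
  apply: epi0 => V h hr0.
  have hf0 : h \cc f = 0.
    by apply: ep; rewrite -compA -ri1 compA hr0 !comp0m.
  have [h' h'g] := cokernel_desc (kernel_is_cokernel fg) hf0.
  suff h'0 : h' = 0 by rewrite -h'g h'0 comp0m.
  by apply: eQ; rewrite -gs compA h'g -ri2 compA hr0 !comp0m.
have [N [n nr]] := has_kernels aC r.
have [u nu] : exists u, n \cc u = i1 \cc k1.
  by apply: (kernel_lift nr); rewrite compA ri1 -compA k1p.1 compm0.
have [v k2v] : exists v, k2 \cc v = p2 \cc n.
  by apply: (kernel_lift k2q); rewrite compA -gr -compA nr.1 compm0.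
have mn := kernel_mono nr; have mk1 := kernel_mono k1p.
have mk2 := kernel_mono k2q; have mf := kernel_mono kf.
have mi1 : mono i1.
  by move=> V a b ab; rewrite -[a]comp1m -[b]comp1m -p1i1 -!compA ab.
exists N, S, u, v, n, r; split=> //; split.
  apply: mono_is_kernel.
  - apply: mono0 => V h uh0; apply: mk1; apply: mi1.
    by rewrite compA -nu -compA uh0 !compm0.
  - by apply: mk2; rewrite compm0 compA k2v -compA nu compA p2i1 comp0m.
  move=> V w vw0.
  (* The [Q] component of [n \cc w] is [k2 \cc v \cc w = 0]. Its [P] component is killed by
     [f \cc p], hence by [p], and lifts to [K1]. *)
  have nw : n \cc w = i1 \cc (p1 \cc (n \cc w)).
    rewrite -[LHS]comp1m -sum compDl -!compA [p2 \cc _]compA.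
    rewrite -k2v -[_ \cc v \cc w]compA.
    by rewrite vw0 !compm0 addr0.
  have [w' k1w'] : exists w', k1 \cc w' = p1 \cc (n \cc w).
    apply: (kernel_lift k1p); apply: mf.
    by rewrite compm0 compA -ri1 -compA -nw compA nr.1 comp0m.
  by exists w'; apply: mn; rewrite compA nu -compA k1w' -nw.
(* [v] is onto: given [e : W -> K2] with [W] projective, [s \cc k2 \cc e]
   factors through [f], then lifts along [p]; subtracting the lift [t'] from
   [k2 \cc e] in [S] gives a map to [N]. *)
apply: epi_from_lifts => W e pW.
have [t ft] : exists t, f \cc t = s \cc k2 \cc e.
  by apply: (kernel_lift kf); rewrite !compA gs k2q.1 comp0m.
have [t' pt'] := pW _ _ p t ep.
have [w nw] : exists w, n \cc w = i2 \cc k2 \cc e - i1 \cc t'.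
  apply: (kernel_lift nr).
  by rewrite compBr !compA ri1 ri2 -ft -[_ \cc p \cc t']compA pt' subrr.
exists w; apply: mk2.
by rewrite compA k2v -compA nw compBr !compA p2i1 p2i2 comp0m subr0 comp1m.
Qed.

(** For [n = 0] the sequence splits and [Y] is a biproduct of projectives; otherwise the horseshoe
    reduces the claim to syzygies. *)
Lemma pd_le_extension n X Y Z (f : Hom X Y) (g : Hom Y Z) :
  ses f g -> pd_le n X -> pd_le n Z -> pd_le n Y.
Proof.
elim: n X Y Z f g => [|n IHn] X Y Z f g fg /=.
  move=> pX pZ; case: (fg) => kf eg.
  have [s gs] := pZ _ _ g (idm Z) eg.
  have gd : g \cc (idm Y - s \cc g) = 0.
    by rewrite compBr compm1 compA gs comp1m subrr.
  (* The retraction [r] of [f] comes from the idempotent complementary to [s \cc g]. *)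
  have [r fr] := kernel_lift kf gd; have mf := kernel_mono kf.
  apply: (@biproduct_projective _ _ _ _ f s r g _ pX pZ); split=> //.
  - by apply: mf; rewrite compA fr compBl -compA kf.1 compm0 subr0 comp1m
      compm1.
  - by apply: mf; rewrite compA fr compBl -compA gs compm1 comp1m subrr compm0.
  - exact: kf.1.
  - by rewrite fr subrK.
case=> K1 [P [k1 [p [k1p pP pK1]]]] [K2 [Q [k2 [q [k2q pQ pK2]]]]].
have [N [S [u [v [m [r [uv mr pS]]]]]]] := horseshoe fg k1p k2q pP pQ.
by exists N, S, m, r; split=> //; exact: IHn uv _ _.
Qed.

(* If [P] is projective onto [Y] with kernel [K], the kernel [N] of
   [P -> Z] is an extension of [X] by [K]. *)
Lemma pd_le_quotient n X Y Z (f : Hom X Y) (g : Hom Y Z) :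
  ses f g -> pd_le n X -> pd_le n.+1 Y -> pd_le n.+1 Z.
Proof.
case=> kf eg pX [K [P [k [p [[kp ep] pP pK]]]]].
have egp : epi (g \cc p) by exact: epi_comp.
have [N [m mgp]] := has_kernels aC (g \cc p).
exists N, P, m, (g \cc p); split=> //.
have [u mu] : exists u, m \cc u = k.
  by apply: (kernel_lift mgp); rewrite -compA kp.1 compm0.
have [v fv] : exists v, f \cc v = p \cc m.
  by apply: (kernel_lift kf); rewrite compA mgp.1.
have mf := kernel_mono kf; have mm := kernel_mono mgp.
have mk := kernel_mono kp.
apply: (@pd_le_extension _ _ _ _ u v) pK pX; split.
  apply: mono_is_kernel.
  - by apply: mono0 => V h uh0; apply: mk; rewrite -mu -compA uh0 !compm0.
  - by apply: mf; rewrite compm0 compA fv -compA mu kp.1.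
  move=> V w vw0.
  have [w' kw'] : exists w', k \cc w' = m \cc w.
    by apply: (kernel_lift kp); rewrite compA -fv -compA vw0 compm0.
  by exists w'; apply: mm; rewrite compA mu kw'.
apply: epi_from_lifts => W e pW.
have [w pw] := pW _ _ p (f \cc e) ep.
have [w' mw'] : exists w', m \cc w' = w.
  by apply: (kernel_lift mgp); rewrite -compA pw compA kf.1 comp0m.
by exists w'; apply: mf; rewrite compA fv -compA mw' pw.
Qed.

End EnoughProjectives.

End Abelian.

(** * Exact functors, adjoints and projectives *)

Section Functors.
Variables (C D : preadditive) (aC : is_abelian C) (aD : is_abelian D).

Lemma exact_functor_ses (T : functor C D) X Y Z (f : @Hom C X Y) (g : Hom Y Z) :
  exact_functor T -> ses f g -> ses (fmap T f) (fmap T g).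
Proof. by case=> _ exT /(short_exact_ses aC) /exT /(short_exact_ses aD). Qed.

Lemma exact_functor_epi (T : functor C D) X Y (f : @Hom C X Y) :
  exact_functor T -> epi f -> epi (fmap T f).
Proof.
move=> exT ef; have [K [k kf]] := has_kernels aC f.
by case: (exact_functor_ses exT (conj kf ef)).
Qed.

Lemma pd_le_functor (T : functor C D) n X :
  exact_functor T -> preserves_projectives T -> pd_le n X -> pd_le n (T X).
Proof.
move=> exT prT; elim: n X => [|n IHn] X; first exact: prT.
case=> K [P [k [p [kp /prT pP /IHn pK]]]].
exists (T K), (T P), (fmap T k), (fmap T p); split=> //.
exact: exact_functor_ses.
Qed.

(** Transpose [f] to a map from [P] to [R Y], lift it along the epimorphism [fmap R p], and
    transpose the lift back. *)
Lemma left_adjoint_preserves_projectives (L : functor C D) (R : functor D C) :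
  adjunction L R -> (forall X Y (f : @Hom D X Y), epi f -> epi (fmap R f)) ->
  preserves_projectives L.
Proof.
move=> adj epR P pP X Y p f /epR eRp.
have [g pg] := pP _ _ (fmap R p) (fmap R f \cc adj_unit adj P) eRp.
exists (adj_counit adj X \cc fmap L g).
have nat_p := nt_natural (adj_counit adj) p.
have nat_f := nt_natural (adj_counit adj) f.
rewrite /= in nat_p nat_f.
rewrite compA -nat_p -compA -fmapM pg fmapM compA nat_f -compA.
by rewrite adj_triangleL compm1.
Qed.

End Functors.

Lemma faithful_epi (C D : preadditive) (T : functor C D) X Y (f : @Hom C X Y) :
  faithful T -> epi (fmap T f) -> epi f.
Proof. by move=> fT ef Z g h gh; apply: fT; apply: ef; rewrite -!fmapM gh. Qed.

(** The triangle identity splits the image of the counit under [R], and a faithful functor reflects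
    epimorphisms. *)
Lemma counit_epi (C D : preadditive) (L : functor C D) (R : functor D C)
  (adj : adjunction L R) X : faithful R -> epi (adj_counit adj X).
Proof.
move=> fR; apply: (faithful_epi fR).
apply: (@epi_cancel _ _ _ _ _ (adj_unit adj (R X))).
by rewrite adj_triangleR; exact: epi_idm.
Qed.

(** * Values of [pd] and [Findim] as extended integers *)

Section Dimension.
Local Open Scope classical_set_scope.
Local Open Scope ereal_scope.

(** [infimum] picks an arbitrary greatest lower bound; the least element of [S] is one, and such
    bounds are unique. *)
Lemma infimum_nat (S : set nat) : S !=set0 ->
  exists n, [/\ S n, lbound S n &
    infimum +oo [set (Posz n)%:E | n in S] = (Posz n)%:E].
Proof.
move=> S0; pose P n := `[< S n >].
have exP : exists n, P n by case: S0 => n Sn; exists n; exact/asboolP.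
case: (ex_minnP exP) => n /asboolP Sn minn.
have lbn : lbound S n by move=> m Sm; apply: minn; exact/asboolP.
exists n; split=> //.
have infn : infimums [set (Posz n)%:E | n in S] (Posz n)%:E.
  split=> [_ [m Sm <-]|y]; last by apply; exists n.
  by rewrite lee_fin; exact: lbn.
rewrite /infimum; case: ifPn => [/eqP eS0|_].
  by move: eS0; rewrite predeqE => /(_ (Posz n)%:E)[+ _]; case; exists n.
case: xgetP => [y _ yinf|/(_ _ infn)//].
exact: (is_subset1_infimums yinf infn).
Qed.

Lemma supremum_nat (S : set (\bar int)) :
  S !=set0 -> (forall x, S x -> exists n, x = (Posz n)%:E) ->
  supremums S (supremum -oo S).
Proof.
move=> S0 Snat.
suff [x supx] : supremums S !=set0.
  rewrite /supremum; case: ifPn => [/eqP eS0|_].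
    by case: S0 => y; rewrite eS0.
  by case: xgetP => [y _ //|/(_ _ supx)].
pose T : set nat := [set n | S (Posz n)%:E].
(* An element of [S] lies below [y], which excludes [-oo] and negative integers. So either [T] is
   bounded and has a supremum, or only [+oo] bounds [S]. *)
have ubT y : ubound S y -> y = +oo \/ exists2 k, y = (Posz k)%:E & ubound T k.
  case: S0 => x0 Sx0 yub; have [m xm] := Snat x0 Sx0.
  have := yub _ Sx0; rewrite xm.
  case: y yub => [[k|k]|_|] yub //; last by left.
  by move=> _; right; exists k => // j /yub; rewrite lee_fin.
have [/nat_supremums_neq0[n [ubn lbn]]|nub] := pselect (ubound T !=set0).
  exists (Posz n)%:E; split=> [x Sx|y /ubT[->|[k -> /lbn nk]]].
  - have [m xm] := Snat x Sx; rewrite xm lee_fin.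
    by apply: ubn; rewrite /T /= -xm.
  - exact: leey.
  - by rewrite lee_fin.
exists +oo; split=> [x _|y /ubT[->//|[k _ kub]]]; first exact: leey.
by case: nub; exists k.
Qed.

Section Findim.
Variable C : preadditive.
Hypothesis aC : is_abelian C.
Implicit Types X : C.

Lemma pd_eq X : pd X < +oo -> exists2 n, pd X = (Posz n)%:E & pd_le n X.
Proof.
rewrite /pd; set S := [set n | _] => S_lt.
(* With no finite resolution the infimum is its default [+oo], against the hypothesis. *)
have [S0|/set0P/infimum_nat[n [Sn _ ->]]] := eqVneq S set0.
  by move: S_lt; rewrite S0 image_set0 /infimum eqxx ltxx.
by exists n => //; case: Sn => R /(resolution_pd_le aC).
Qed.

Lemma le_pd n X : pd_le n X -> pd X <= (Posz n)%:E.
Proof.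
move=> /(pd_le_resolution aC) Sn; rewrite /pd.
have [|m [_ lbm ->]] := @infimum_nat
  [set n | exists R : projective_resolution X, resolution_length_le R n].
  by exists n.
by rewrite lee_fin; exact: lbm.
Qed.

Lemma pd_leP n X : pd X <= (Posz n)%:E <-> pd_le n X.
Proof.
split=> [Xn|]; last exact: le_pd.
have [|m Xm] := @pd_eq X; first exact: le_lt_trans Xn (ltry _).
by apply: (pd_le_leq aC); move: Xn; rewrite Xm lee_fin.
Qed.

Lemma Findim_supremums :
  supremums [set pd X | X in [set X : C | pd X < +oo]] (Findim C).
Proof.
apply: supremum_nat; last by move=> _ [X /pd_eq[n Xn _] <-]; exists n.
(* A zero object makes the set nonempty, so the default [-oo] of [supremum] never arises. *)
have [Z Z0] := has_zero aC; exists (pd Z), Z => //=.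
have : pd_le 0 Z by exact: zero_object_projective.
by move=> /le_pd Zle; exact: le_lt_trans Zle (ltry _).
Qed.

End Findim.

(** Common shape of both inequalities. The bound on [Y] by [m] serves to make [pd Y] a finite [k];
    the index [maxn k n] then bounds [Y], reaches the threshold [n], and so bounds [X]. *)
Lemma Findim_le_max (C D : preadditive) n :
  is_abelian C -> is_abelian D ->
  (forall m (X : C), pd_le m X -> exists Y : D, pd_le m Y /\
     forall j, (n <= j)%N -> pd_le j Y -> pd_le j X) ->
  Findim C <= Order.max (Findim D) (Posz n)%:E.
Proof.
move=> aC aD CD; have [_ lub] := Findim_supremums aC; apply: lub.
move=> _ [X /(pd_eq aC)[m _ /CD[Y [mY YX]]] <-].
have Y_lt : pd Y < +oo by exact: le_lt_trans (le_pd aD mY) (ltry _).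
have [k Yk kY] := pd_eq aD Y_lt.
have YF : pd Y <= Findim D.
  by have [ub _] := Findim_supremums aD; apply: ub; exists Y.
apply: (@le_trans _ _ (Posz (maxn k n))%:E).
  apply/(pd_leP aC)/YX; first exact: leq_maxr.
  by apply: (pd_le_leq aD) kY; exact: leq_maxl.
rewrite le_max; case: (leqP k n) => _; last by rewrite -Yk YF.
by rewrite lexx orbT.
Qed.

End Dimension.

(** * Comparison of finitistic dimensions along a cleft extension *)

Local Open Scope ereal_scope.

Theorem theorem4p1 (A B : abelian_category) (c : cleft_extension B A)
    (A_enough : enough_projectives A) (B_enough : enough_projectives B)
    (l_exact : exact_functor (cl_l c))
    (e_proj : preserves_projectives (cl_e c))
    (nB nA : nat)
    (F_pd : forall X : B, essential_image (cleft_F c) X -> pd X <= (Posz nB)%:E)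
    (G_pd : forall X : A, essential_image (cleft_G c) X -> pd X <= (Posz nA)%:E) :
  [/\ Findim A <= Order.max (Findim B) (Posz nA.+1)%:E,
      Findim B <= Order.max (Findim A) (Posz nB.+1)%:E &
      Findim A < +oo <-> Findim B < +oo].
Proof.
have aA := ab_axioms A; have aB := ab_axioms B; have e_exact := cl_exact c.
have l_proj : preserves_projectives (cl_l c).
  apply: (left_adjoint_preserves_projectives (cl_adj c)) => X Y f.
  exact: exact_functor_epi.
have mu_ses X : ses (ker (adj_counit (cl_adj c) X)) (adj_counit (cl_adj c) X).
  by split; [exact: kerP | exact: counit_epi (@cl_faithful _ _ c)].
have FA : Findim A <= Order.max (Findim B) (Posz nA.+1)%:E.
  apply: Findim_le_max => // m X mX.
  exists (cl_e c X); split; first exact: pd_le_functor.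
  (* The threshold [nA.+1] excludes index 0. At index [j.+1], [nj] says [nA <= j], so the kernel has
     the bound [j], one less than the middle term, as the quotient estimate requires. *)
  case=> // j nj eX; apply: (pd_le_quotient aA A_enough (mu_ses X)).
    apply: (@pd_le_leq _ aA nA j _ nj).
    apply/(pd_leP aA)/G_pd.
    by exists X; exact: isomorphic_refl.
  exact: (pd_le_functor aB aA l_exact).
have FB : Findim B <= Order.max (Findim A) (Posz nB.+1)%:E.
  apply: Findim_le_max => // m X mX.
  have eiX : isomorphic (cl_e c (cl_i c X)) X.
    by exists (cl_section c X); exact: (@ni_iso _ _ _ _ (cl_section c)).
  exists (cl_l c (cl_e c (cl_i c X))); split.
    apply: pd_le_functor => //.
    by apply: pd_le_isomorphic mX; exact: isomorphic_sym.
  case=> // j nj leX; apply: (pd_le_isomorphic eiX).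
  (* The image under [e] of the counit sequence at [i X] has [cleft_F c X] as its first term, by
     definition. *)
  apply: (pd_le_quotient aB B_enough
    (exact_functor_ses aA aB e_exact (mu_ses (cl_i c X)))).
    apply: (@pd_le_leq _ aB nB j _ nj).
    apply/(pd_leP aB)/F_pd.
    by exists X; exact: isomorphic_refl.
  exact: (pd_le_functor aA aB e_exact).
split=> //; split=> fin.
  by apply: le_lt_trans FB _; rewrite gt_max fin ltry.
by apply: le_lt_trans FA _; rewrite gt_max fin ltry.
Qed.
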